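(* Let $G$ be a parsimonious game with $h\ge2$ types and free type representation $(x_1,\ldots,x_{h-1})$, and let $q_h(x_1,\ldots,x_{h-1})$ denote its minimal winning quota. For each positive integer $s<h$ let $I(h,s)$ be the set of all integer sequences $(i_1,\ldots,i_s)$ of positive integers such that $i_1$ is odd, $i_j<i_{j+1}$ and $i_j+i_{j+1}$ is odd for $j=1,\ldots,s-1$, and $i_s<h$. Then: if $h$ is even, $$q_h(x_1,\ldots,x_{h-1})=\sum_{\substack{1\le s<h\\ s \text{ odd}}}\ \sum_{(i_1,\ldots,i_s)\in I(h,s)}\ \prod_{j=1}^{s}x_{i_j};$$ if $h$ is odd, $$q_h(x_1,\ldots,x_{h-1})=1+\sum_{\substack{2\le s<h\\ s \text{ even}}}\ \sum_{(i_1,\ldots,i_s)\in I(h,s)}\ \prod_{j=1}^{s}x_{i_j}.$$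
   Context: A constant sum homogeneous weighted majority game on a finite player set $N$ is a simple game ($v(S)\in\{0,1\}$ for every $S\subseteq N$), constant sum ($v(S)+v(N\setminus S)=1$), admitting a (unique) minimal homogeneous representation $(q,\mathbf{w})$: the individual weights $w_j$ are integers in nondecreasing order, some players have weight $1$, $v(S)=1$ if and only if $w(S):=\sum_{j\in S}w_j\ge q$, with $q=\frac{1+w(N)}{2}$, and $w(S)=q$ for every minimal winning coalition $S$ (a coalition with $v(S)=1$ and $v(T)=0$ for all $T\subsetneq S$). The number $q$ is the minimal winning quota of the game. A parsimonious game ($P$ game) is a constant sum homogeneous weighted majority game with $n>3$ players, none of them dummy, having exactly $n$ minimal winning coalitions (the smallest possible number). Recalled facts about $P$ games (known, due to earlier work). Group the players by equal weight in the minimal homogeneous representation into $h$ types ($2\le h\le n-2$) with type weights $w_1<w_2<\cdots<w_h$, and let $x_t\geq 1$ be the number of players of type $t$. Then $x_1>1$, $x_{h-1}>1$, $x_h=1$. The vector $(x_1,\ldots,x_h)$ is the type representation, and $(x_1,\ldots,x_{h-1})$ is the free type representation; it determines the game. With the convention $w_0=0$, the type weights satisfy $w_1=1$, $w_t=x_{t-1}w_{t-1}+w_{t-2}$ for $1<t<h$, and $w_h=(x_{h-1}-1)w_{h-1}+w_{h-2}$. *)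

(* Defs.v *)
From HB Require Import structures.
From mathcomp Require Import all_boot all_order all_algebra.

Set Implicit Arguments.
Unset Strict Implicit.
Unset Printing Implicit Defensive.

Import Order.TTheory GRing.Theory Num.Theory.
Local Open Scope ring_scope.

(* A simple game is its characteristic function [v : {set N} -> bool]; the     *)
(* booleans stand for the values 0 and 1 (and coerce to them).                 *)
Definition constant_sum (N : finType) (v : {set N} -> bool) : Prop :=
  forall S : {set N}, (v S + v (~: S) = 1)%N.

Definition min_winning (N : finType) (v : {set N} -> bool) : {set {set N}} :=
  [set S | minset v S].

Definition dummy (N : finType) (v : {set N} -> bool) (i : N) : Prop :=
  forall S : {set N}, S \in min_winning v -> i \notin S.

Definition weight (N : finType) (w : N -> int) (S : {set N}) : int :=
  \sum_(j in S) w j.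

(* The player set carries no order: listing the weights in nondecreasing order *)
(* is a choice of labelling, and is done by [type_weights] below.              *)
Definition min_hom_rep (N : finType) (v : {set N} -> bool)
    (q : int) (w : N -> int) : Prop :=
  [/\ exists i : N, w i = 1,
      forall S : {set N}, v S = (q <= weight w S),
      2 * q = 1 + weight w [set: N]
    & forall S : {set N}, S \in min_winning v -> weight w S = q].

Definition cs_homogeneous_game (N : finType) (v : {set N} -> bool) : Prop :=
  constant_sum v /\ exists (q : int) (w : N -> int), min_hom_rep v q w.

Definition parsimonious (N : finType) (v : {set N} -> bool) : Prop :=
  [/\ cs_homogeneous_game v,
      (3 < #|N|)%N,
      forall i : N, ~ dummy v i
    & #|min_winning v| = #|N|].

(* The distinct weights w_1 < ... < w_h.                                       *)
Definition type_weights (N : finType) (w : N -> int) : seq int :=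
  sort <=%R (undup (codom w)).

Definition ntypes (N : finType) (w : N -> int) : nat := size (type_weights w).

Definition type_rep (N : finType) (w : N -> int) : seq nat :=
  [seq #|[set j : N | w j == a]| | a <- type_weights w].

Definition free_type_rep (N : finType) (w : N -> int) : seq nat :=
  take (ntypes w).-1 (type_rep w).

(* I(h, s) for s >= 1. Entries of an element are all < h because they increase *)
(* and the last one is < h; taking them in ['I_h] makes I(h, s) a finite set.  *)
Definition I_set (h s : nat) : {set s.-tuple 'I_h} :=
  [set i : s.-tuple 'I_h |
    [&& all (fun k : 'I_h => 0 < k)%N i,
        odd (head 0%N (map val i))
      & sorted (fun a b : 'I_h => (a < b)%N && odd (a + b)) i]].

(* x_i is 1-indexed, hence the [.-1].                                          *)
Definition I_sum (x : seq nat) (h s : nat) : nat :=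
  (\sum_(i in I_set h s) \prod_(j < s) nth 0 x (tnth i j).-1)%N.

(* Main.v *)
Require Import Defs.
From HB Require Import structures.
From mathcomp Require Import all_boot all_order all_algebra zify.
Import Order.TTheory GRing.Theory Num.Theory.

(** With positive integer weights the minimal winning coalitions are the
    subsets of weight exactly q. List the weights in nonincreasing order a_1 >=
    ... >= a_n and build these subsets by deciding player after player; call q
    minus the weight already taken the residual. Homogeneity forces every live
    residual at level j to be at least a_j, and since there are no dummies each
    level j < n has a residual for which both taking and skipping j can be
    completed, so there are at least n minimal winning coalitions. If there are
    exactly n, then one residual branches at each level, there are always
    exactly two live residuals, and they evolve by the subtractive Euclidean
    algorithm, from (q - a_1, q) at level 2 down to (1, 1) at level n. Grouping
    equal weights turns this into the continuant recursion w_{t+1} = x_t w_t +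
    w_{t-1}, with q in the place of w_h; the sums over I(h, s) obey the same
    recursion, by splitting off the last index. *)

(** * Completions of a homogeneous residual *)

(* Number of sublists of [l], counted by position, with sum [m]. *)
Fixpoint hits (m : nat) (l : seq nat) : nat :=
  if l is a :: l' then hits m l' + (if a <= m then hits (m - a) l' else 0)
  else (m == 0).

(* Residual [m] at the players with weights [l]: each minimal completion of the
   coalition built so far has weight exactly [m]. *)
Definition homog (m : nat) (l : seq nat) : Prop :=
  forall t, subseq t l -> m <= sumn t ->
    (forall x, x \in t -> sumn t < m + x) -> sumn t = m.

(** This is how absence of dummies enters the count: the lightest player [z] belongs to some
    completion of [m]. *)
Definition uses_last (m : nat) (k : seq nat) (z : nat) : Prop :=
  exists2 t, subseq t k & sumn t + z = m.

(* In the Euclidean chain the live residuals at [l] are [head 0 l] and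
   [(sumn (behead l)).+1]. *)
Fixpoint chain (l : seq nat) : bool :=
  match l with
  | a :: ((b :: l'') as l') => ((a == b) || (a == (sumn l'').+1)) && chain l'
  | [:: a] => a == 1
  | [::] => true
  end.

Lemma hits_gt m l : sumn l < m -> hits m l = 0.
Proof.
elim: l m => [|a l IHl] m /=; first by case: m.
by move=> lt_m; rewrite IHl; [case: ifP => // le_am; rewrite IHl //; lia | lia].
Qed.

Lemma hits0 l : all (leq 1) l -> hits 0 l = 1.
Proof.
elim: l => [|a l IHl] //= /andP[a_gt0 /IHl ->].
by rewrite leqNgt a_gt0.
Qed.

(** If [m < a], the singleton [[:: a]] would be a minimal completion of weight other than [m]. *)
Lemma homog_head_le m a l : 0 < m -> homog m (a :: l) -> a <= m.
Proof.
move=> m_gt0 hom; case: (leqP a m) => // lt_ma.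
suff : sumn [:: a] = m.
  by rewrite /= addn0 => eq_am; rewrite eq_am ltnn in lt_ma.
apply: hom => [|/=|x]; first by rewrite /= eqxx sub0seq.
  by lia.
by rewrite inE => /eqP -> /=; lia.
Qed.

Lemma homog_skip m a l : homog m (a :: l) -> homog m l.
Proof.
move=> hom t sub_t; apply: hom.
exact: subseq_trans sub_t (subseq_cons _ _).
Qed.

Lemma homog_take m a l :
  all (geq a) l -> 0 < m -> homog m (a :: l) -> homog (m - a) l.
Proof.
move=> le_a m_gt0 hom; have le_am := homog_head_le _ _ _ m_gt0 hom.
move=> t sub_t le_t min_t.
(* Minimality of [a :: t] also requires that [a] cannot be dropped. For nonempty [t] this follows
   from minimality of [t], whose entries are at most [a]. *)
have lt_t : sumn t < m.
  case: t sub_t le_t min_t => [|y t] sub_t le_t min_t //.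
  have := min_t y (mem_head _ _).
  have /= := allP le_a y (mem_subseq sub_t (mem_head _ _)); lia.
have /= : sumn (a :: t) = m.
  apply: hom => /=; rewrite ?eqxx //; first lia.
  by move=> x; rewrite inE => /predU1P[->|/min_t]; lia.
lia.
Qed.

(** Greedy choice: taking each player in turn until the residual is 0 never overshoots. *)
Lemma hits_gt0 m l :
  sorted geq l -> all (leq 1) l -> m <= sumn l -> homog m l -> 0 < hits m l.
Proof.
elim: l m => [|a l IHl] m /=; first by rewrite leqn0 => _ _ ->.
rewrite (path_sortedE (rev_trans leq_trans)) => /andP[le_a sl] /andP[a_gt0 pl].
move=> le_m hom; case: (posnP m) => [->|m_gt0].
  by rewrite (hits0 l) // addn_gt0.
rewrite (homog_head_le _ _ _ m_gt0 hom).
rewrite ltn_addl // IHl //; first lia.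
exact: homog_take hom.
Qed.

Lemma uses_last_cons m a k z :
  uses_last m (a :: k) z ->
  uses_last m k z \/ (a + z <= m /\ uses_last (m - a) k z).
Proof.
case=> -[|b t] /= sub_t <-; first by left; exists [::]; rewrite ?sub0seq.
case: eqP sub_t => [->|_] sub_t; last by left; exists (b :: t).
by right; split; [lia | exists t => //; lia].
Qed.

Lemma uses_last_le m k z : uses_last m k z -> m <= sumn (rcons k z).
Proof.
case=> t /subseqP[b sz ->] <-; rewrite sumn_rcons leq_add2r.
elim: b k sz => [|c b IHb] [|y k] //= [/IHb]; case: c => /=; lia.
Qed.

(** * Two live residuals and the subtractive Euclidean algorithm *)

(** Invariant: [r + s] exceeds the remaining weight by one. If the head equals the smaller residual,
    one completion is finished and one pair with the same invariant remains; if it is smaller than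
    both, two such pairs survive and the count is too large for equality. *)
Lemma chain_of_hits k z r s (l := rcons k z) :
    sorted geq l -> all (leq 1) l -> 0 < r -> 0 < s ->
    r + s = (sumn l).+1 -> homog r l -> homog s l ->
    uses_last r k z \/ uses_last s k z ->
  size l < hits r l + hits s l /\
  (hits r l + hits s l = (size l).+1 ->
   chain l /\ (head 0 l = r \/ head 0 l = s)).
Proof.
rewrite {}/l; elim: k r s => [|a k IHk] r s.
  move=> _ /= /andP[z_gt0 _] r_gt0 s_gt0; rewrite addn0 => eq_rs hr hs _.
  have := homog_head_le _ _ _ r_gt0 hr; have := homog_head_le _ _ _ s_gt0 hs.
  move=> le_zs le_zr; have [-> [-> ->]] : z = 1 /\ r = 1 /\ s = 1 by lia.
  by split => // _; split=> //; left.
set l := rcons k z; wlog le_rs : r s / r <= s => [hwlog|].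
  case: (leqP r s) => [|/ltnW le_sr]; first exact: hwlog.
  move=> sl pl r_gt0 s_gt0 eq_rs hr hs us.
  rewrite addnC or_comm; apply: hwlog => //; first by rewrite addnC.
  by rewrite or_comm.
rewrite rcons_cons -/l => sal pal r_gt0 s_gt0 eq_rs hr hs us.
have le_ar := homog_head_le _ _ _ r_gt0 hr.
have le_as := leq_trans le_ar le_rs.
move: (sal) (pal); rewrite /= (path_sortedE (rev_trans leq_trans)).
case/andP=> le_a sl /andP[a_gt0 pl].
have l_gt0 : 0 < size l by rewrite size_rcons.
have z_gt0 : 0 < z by have := allP pl z; rewrite mem_rcons mem_head => /(_ isT).
have hrS := homog_skip _ _ _ hr; have hsS := homog_skip _ _ _ hs.
have hrT := homog_take _ _ _ le_a r_gt0 hr.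
have hsT := homog_take _ _ _ le_a s_gt0 hs.
rewrite le_ar le_as; move: eq_rs => /= eq_rs.
have [eq_ra|lt_ar] : a = r \/ a < r by lia.
  subst r; rewrite subnn (hits0 l) //.
  have [eq_sa|lt_as] : s = a \/ a < s by lia.
    (* With both residuals equal to [a], the rest weighs only [a - 1], so no completion contains
       [z]. *)
    exfalso; subst s.
    have {us} : uses_last a (a :: k) z by case: us.
    by case/uses_last_cons=> [/uses_last_le|[]]; rewrite -/l; lia.
  (* Here [s = (sumn l).+1], so [s] cannot be completed without [a]: the pair [(a, s)] becomes
     [(a, s - a)]. *)
  rewrite (hits_gt s); last by lia.
  have us' : uses_last a k z \/ uses_last (s - a) k z.
    have lt_sl : ~ uses_last s k z by move/uses_last_le; rewrite -/l; lia.
    case: us => /uses_last_cons[|[]] //; first by left.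
      by move=> le_aza; lia.
    by right.
  have sa_gt0 : 0 < s - a by lia.
  have eq_sa : a + (s - a) = (sumn l).+1 by lia.
  have [lb eqb] := IHk a (s - a) sl pl a_gt0 sa_gt0 eq_sa hrS hsT us'.
  rewrite -/l in lb eqb.
  split=> [|eq_hits]; first lia.
  case: eqb => [|ch hd]; first lia.
  split; last by left.
  move: ch hd eq_sa {us' us IHk}; rewrite -/l.
  case: (l) l_gt0 => [|b l'] //= _ -> hd eq_sa; rewrite andbT.
  by apply/orP; case: hd => hd; [left | right]; apply/eqP; lia.
have lt_as : a < s by lia.
have ge1 m : m <= sumn l -> homog m l -> 0 < hits m l by exact: hits_gt0.
have ra_gt0 : 0 < r - a by lia.
have sa_gt0 : 0 < s - a by lia.
have [h1 h2 h3 h4] : [/\ 0 < hits r l, 0 < hits s l, 0 < hits (r - a) l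
    & 0 < hits (s - a) l] by split; apply: ge1 => //; lia.
have eq1 : r + (s - a) = (sumn l).+1 by lia.
have eq2 : (r - a) + s = (sumn l).+1 by lia.
(* One of the two pairs has a completion through [z]. Induction applies to it, and the other pair
   adds at least 2. *)
have [u|u] : (uses_last r k z \/ uses_last (s - a) k z) \/
             (uses_last (r - a) k z \/ uses_last s k z).
  by case: us => /uses_last_cons[|[]]; tauto.
  have [lb _] := IHk r (s - a) sl pl r_gt0 sa_gt0 eq1 hrS hsT u.
  by rewrite -/l in lb; split; lia.
have [lb _] := IHk (r - a) s sl pl ra_gt0 s_gt0 eq2 hrT hsS u.
by rewrite -/l in lb; split; lia.
Qed.

(** Deciding on [a1] leaves the residuals [q] and [q - a1], with sum [(sumn l).+1]: the equality
    case applies. That [a1] is not repeated is the fact [x_h = 1]. *)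
Lemma chain_top a1 k z q (l := rcons k z) :
    2 < size l -> sorted geq (a1 :: l) -> all (leq 1) (a1 :: l) ->
    2 * q = (sumn (a1 :: l)).+1 -> homog q (a1 :: l) ->
    uses_last q (a1 :: k) z -> hits q (a1 :: l) = size (a1 :: l) ->
  [/\ chain l, a1 \notin l & q = (sumn (behead l)).+1].
Proof.
move=> l_gt2 /=; rewrite (path_sortedE (rev_trans leq_trans)).
case/andP=> le_a sl /andP[a_gt0 pl] eq_q hom us.
have q_gt0 : 0 < q by lia.
have le_aq := homog_head_le _ _ _ q_gt0 hom.
rewrite le_aq => eq_hits.
have lt_aq : a1 < q.
  case: ltngtP le_aq => // eq_aq _; subst a1.
  by move: eq_hits; rewrite subnn hits0 // hits_gt; lia.
have qa_gt0 : 0 < q - a1 by lia.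
have eqs : q + (q - a1) = (sumn l).+1 by lia.
have us' : uses_last q k z \/ uses_last (q - a1) k z.
  by case/uses_last_cons: us => [|[]]; tauto.
have [_] := chain_of_hits k z q (q - a1) sl pl q_gt0 qa_gt0 eqs
  (homog_skip _ _ _ hom) (homog_take _ _ _ le_a q_gt0 hom) us'.
rewrite -/l => /(_ eq_hits) [ch hd].
have l_le : all (leq^~ (head 0 l)) l.
  move: sl; case: (l) => //= b l'.
  by rewrite (path_sortedE (rev_trans leq_trans)) leqnn => /andP[].
move: l_gt2 le_a sl pl ch hd eqs l_le {us' us eq_hits}.
case: (l) => [|a2 [|a3 [|a4 l']]] //= _ /and4P[le2 _ _ _] _.
move=> /and4P[a2_gt0 a3_gt0 a4_gt0 _] /and3P[ch2 ch3 ch4] hd eqs.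
move=> /and4P[_ le3 le4 /allP le5].
have eq_a2 : a2 = q - a1 by lia.
split; [by rewrite ch2 ch3 | | lia].
(* If [a1 = a2], the first two links of the chain contradict [eqs]; they exist because [l] has at
   least three entries. *)
have lt21 : a2 < a1.
  by case/orP: ch2 => /eqP ?; case/orP: ch3 => /eqP ?; lia.
by rewrite !inE; apply/negP => /or4P[/eqP|/eqP|/eqP|/le5]; lia.
Qed.

(** * From the chain to the continuant recursion *)

(** Sends [(w_{t-1}, w_t)] to [(w_t, x_t * w_t + w_{t-1})]; the start [(0, 1)] below is
    [(w_0, w_1)]. *)
Definition euclid_step (x : nat) (pc : nat * nat) := (pc.2, x * pc.2 + pc.1).

Definition multiplicities (l : seq nat) : seq nat :=
  [seq count_mem a l | a <- undup l].

Lemma head_undup (l : seq nat) : sorted geq l -> head 0 (undup l) = head 0 l.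
Proof.
elim: l => //= a l IHl sal; case: ifP => // a_in.
rewrite IHl ?(path_sorted sal) //.
move: sal a_in; rewrite (path_sortedE (rev_trans leq_trans)).
case: l {IHl} => //= b l /andP[/andP[le_ba _]].
rewrite (path_sortedE (rev_trans leq_trans)) => /andP[/allP le_b _].
rewrite inE => /predU1P[//|/le_b /=]; lia.
Qed.

(** A repeated head raises the leading multiplicity by one. A new head must equal the second
    component, by [chain], which is a step with multiplicity 1. *)
Lemma chain_multiplicities l : l != [::] -> sorted geq l -> chain l ->
  foldr euclid_step (0, 1) (multiplicities l) =
    (head 0 l, (sumn (behead l)).+1).
Proof.
elim: l => // a [|b l] IHl _ sal.
  by rewrite /= => /eqP ->.
have sl : sorted geq (b :: l) by exact: path_sorted sal.
case/andP=> ab ch; have {IHl} := IHl isT sl ch.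
have le_ba : b <= a by case/andP: sal.
have := head_undup _ sl; have uniq_u := undup_uniq (b :: l).
have mem_u := mem_undup (b :: l).
have all_le : all (geq b) l.
  by move: sl; rewrite /= (path_sortedE (rev_trans leq_trans)) => /andP[].
rewrite /multiplicities.
have -> : undup (a :: b :: l) =
  if a \in b :: l then undup (b :: l) else a :: undup (b :: l) by [].
case: ifPn => [a_in|a_notin].
  have {ab} eq_ab : a = b.
    by move: a_in; rewrite inE => /predU1P[//|/(allP all_le) /=]; lia.
  subst b; case: (undup (a :: l)) uniq_u mem_u => [|c u].
    by move=> _ /(_ a); rewrite mem_head.
  move=> /= /andP[c_notin _] _ eq_ca; subst c; rewrite eqxx.
  have /= -> : [seq count_mem x [:: a, a & l] | x <- u] =
               [seq count_mem x (a :: l) | x <- u].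
    apply/eq_in_map => x x_in /=.
    by case: eqP c_notin => // ->; rewrite x_in.
  rewrite /euclid_step /=; case=> -> eq_s.
  by congr pair; rewrite mulnDl mul1n -addnA eq_s addnS.
move=> hd; rewrite map_cons /= eqxx.
have /negPf-> : b != a by apply: contraNneq a_notin => ->; rewrite mem_head.
have -> : count_mem a l = 0.
  by apply/count_memPn; apply: contra a_notin => a_in; rewrite inE a_in orbT.
have /= -> : [seq count_mem x [:: a, b & l] | x <- undup (b :: l)] =
             [seq count_mem x (b :: l) | x <- undup (b :: l)].
  apply/eq_in_map => x; rewrite mem_u => x_in /=; case: eqP => // eq_ax.
  by move: a_notin; rewrite eq_ax x_in.
move=> /= ->; rewrite /euclid_step /=.
have /eqP -> : a == (sumn l).+1.
  case/orP: ab => // /eqP eq_ab.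
  by move: a_notin; rewrite eq_ab mem_head.
by congr pair; lia.
Qed.

(** * Sums over alternating index sequences *)

(** Paths start at 0, so that the first link says that [i_1] is positive and odd. *)
Definition alternating (a b : nat) := (a < b) && odd (a + b).

(** Entries live in a fixed ['I_M] while the bound [h] varies, so recursion on [h] keeps one type of
    indices. The empty sequence is allowed, with last entry 0 and product 1. *)
Definition alt_sum (x : seq nat) (M h s : nat) : nat :=
  \sum_(i : s.-tuple 'I_M | path alternating 0 (map val i) &&
                            (last 0 (map val i) < h))
     \prod_(k <- i) nth 0 x k.-1.

Lemma odd_last_alternating a t :
  path alternating a t -> odd (last a t) = odd (a + size t).
Proof.
elim: t a => [|b t IHt] a /=; first by rewrite addn0.
by case/andP=> /andP[_ odd_ab] /IHt ->; move: odd_ab; rewrite !oddD /=;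
  do 3!case: odd.
Qed.

(** Only positive lengths agree: [I_set] rejects the empty sequence, whose head defaults to 0. *)
Lemma I_sumE x h s : I_sum x h s.+1 = alt_sum x h h s.+1.
Proof.
rewrite /I_sum /alt_sum; apply: eq_big => [i|i _]; last by rewrite big_tuple.
rewrite inE; case: i => -[|a t] //= _.
rewrite /alternating add0n -/alternating path_map.
have -> : (last (val a) (map val t) < h) = true.
  by rewrite last_map; exact: ltn_ord.
rewrite andbT /=; set sorted_t := path _ a t.
rewrite -/sorted_t.
rewrite -!andbA; case: (0 < a) => //=.
rewrite andbCA; congr (_ && _).
case st: sorted_t; rewrite ?andbF // andbT.
apply/allP => k k_in.
have: path (fun a b : 'I_h => a < b) a t.
  by apply: sub_path st => c d /andP[].
rewrite path_sortedE => [/andP[/allP/(_ k k_in)]|u v w]; first lia.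
exact: ltn_trans.
Qed.

Lemma alt_sum0 x M h : alt_sum x M h 0 = (0 < h).
Proof.
rewrite /alt_sum; case: h => [|h].
  by rewrite big_pred0 // => i; rewrite andbF.
rewrite (big_pred1 [tuple]) => [|i]; first by rewrite big_nil.
by rewrite [i]tuple0 /= eqxx.
Qed.

Lemma alt_sum_bound0 x M s : alt_sum x M 0 s = 0.
Proof. by rewrite /alt_sum big_pred0 // => i; rewrite andbF. Qed.

Lemma big_rcons_tuple (T : finType) s (F : s.+1.-tuple T -> nat) P :
  \sum_(t | P t) F t =
  \sum_(k : T) \sum_(t : s.-tuple T | P [tuple of rcons t k])
     F [tuple of rcons t k].
Proof.
rewrite pair_big_dep /=.
rewrite (reindex (fun p : T * s.-tuple T => [tuple of rcons p.2 p.1])) //=.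
apply: onW_bij; apply: inj_card_bij.
  move=> [k t] [k' t'] /(congr1 val) /= /rcons_inj[eq_t ->].
  by congr pair; apply: val_inj.
by rewrite card_prod !card_tuple expnS.
Qed.

(** The last index is below [h] or equal to [h]. The latter forces [h] and the length to have the
    same parity, and removing it leaves a sequence of length [s] below [h]. *)
Lemma alt_sum_rec x M h s : h < M ->
  alt_sum x M h.+1 s.+1 =
  alt_sum x M h s.+1 +
    (odd h == odd s.+1) * (nth 0 x h.-1 * alt_sum x M h s).
Proof.
move=> lt_hM; rewrite /alt_sum (bigID (fun i : s.+1.-tuple 'I_M =>
  last 0 (map val i) < h)) /=; congr addn.
  by apply: eq_bigl => i; lia.
rewrite big_rcons_tuple (bigD1 (Ordinal lt_hM)) //= [X in _ + X]big1 ?addn0.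
  case: eqP => [par|npar]; rewrite ?mul1n ?mul0n; last first.
    apply: big_pred0 => t; rewrite map_rcons last_rcons rcons_path ltnn /=.
    case pt: path => //=; have := odd_last_alternating _ _ pt.
    rewrite add0n size_map size_tuple /alternating oddD => ->.
    by move: npar => /=; do 2!case: odd; rewrite ?andbF.
  rewrite big_distrr /=; apply: eq_big => t.
    rewrite map_rcons last_rcons rcons_path ltnn ltnSn !andbT.
    case pt: path => //=; have := odd_last_alternating _ _ pt.
    rewrite add0n size_map size_tuple /alternating oddD => ->.
    by rewrite par /=; case: odd; rewrite andbT.
  by move=> _; rewrite big_rcons /= mulnC.
move=> k /eqP ne_k; apply: big_pred0 => t.
rewrite map_rcons last_rcons; apply: contra_notF ne_k.
move=> /andP[/andP[_ le1] le2]; apply: val_inj => /=; lia.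
Qed.

Lemma alt_sum_eq0 x M h s : h <= M -> 0 < s -> h <= s -> alt_sum x M h s = 0.
Proof.
elim: h s => [|h IHh] [|s] //; first by rewrite alt_sum_bound0.
move=> lt_hM _ le_hs; rewrite alt_sum_rec // IHh ?(ltnW lt_hM) //; last lia.
case: s le_hs => [|s] le_hs; last by rewrite IHh ?(ltnW lt_hM) // !muln0.
have -> : h = 0 by lia.
by rewrite alt_sum_bound0 !muln0.
Qed.

(** Solves the continuant recursion with initial values 0 and 1; at the number of types it will be
    the quota. *)
Definition parity_sum x M h := \sum_(s < h | odd s != odd h) alt_sum x M h s.

Lemma parity_sum_rec x M h : h.+1 < M ->
  parity_sum x M h.+2 =
  nth 0 x h * parity_sum x M h.+1 + parity_sum x M h.
Proof.
move=> lt_hM; have lt_hM' := ltnW lt_hM.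
(* The two added terms vanish: length [h] by parity, length [h.+1] because it is too long. *)
have -> : parity_sum x M h =
    \sum_(s < h.+2 | odd s != odd h) alt_sum x M h s.
  rewrite big_mkcond !big_ord_recr /= eqxx addn0 alt_sum_eq0 ?(ltnW lt_hM') //.
  by rewrite if_same addn0 -big_mkcond.
rewrite /parity_sum big_distrr big_mkcond big_ord_recl /= alt_sum0.
rewrite [X in _ = X + _]big_mkcond [X in _ = _ + X]big_mkcond.
rewrite [X in _ = _ + X]big_ord_recl /= alt_sum0 addnCA; congr addn.
  (* The empty sequence is counted only for odd [h], and then [0 < h]. *)
  by rewrite negbK; case: (h) => [|h'] //=; case: odd.
rewrite -big_split /=; apply: eq_bigr => s _; rewrite /bump /= !add1n.
(* For lengths of parity opposite to [h], only the split at last index [h.+1] contributes, not the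
   one at [h]. *)
rewrite alt_sum_rec // [alt_sum x M h.+1 s.+1]alt_sum_rec //=.
by do 2!case: odd; rewrite //= ?mul1n ?mul0n ?addn0 // addnC.
Qed.

Lemma parity_sum_foldr x M i : i < M -> i <= size x ->
  foldr euclid_step (0, 1) (rev (take i x)) =
  (parity_sum x M i, parity_sum x M i.+1).
Proof.
elim: i => [|i IHi] lt_iM le_ix.
  rewrite take0 /= /parity_sum big_ord0 big_mkcond big_ord_recl big_ord0 /=.
  by rewrite alt_sum0.
rewrite (take_nth 0) // rev_rcons /= IHi ?(ltnW lt_iM) ?(ltnW le_ix) //.
by rewrite parity_sum_rec.
Qed.

(** The summand 1 for odd [h] is the empty sequence, of even length. *)
Lemma parity_sum_I_sum x h : 0 < h ->
  parity_sum x h h =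
  if odd h then 1 + \sum_(2 <= s < h | ~~ odd s) I_sum x h s
  else \sum_(1 <= s < h | odd s) I_sum x h s.
Proof.
move=> h_gt0; rewrite /parity_sum -(big_mkord (fun s => odd s != odd h)).
rewrite big_ltn_cond //= alt_sum0 h_gt0; case: (odd h) => /=.
  congr addn; case: (ltnP 1 h) => [lt1h|le_h1]; last first.
    by rewrite !big_geq //; exact: ltnW.
  rewrite big_ltn_cond //= big_nat_cond [RHS]big_nat_cond.
  apply: eq_big => [s|[|s]]; [by case: (odd s) | by [] |].
  by rewrite I_sumE.
rewrite big_nat_cond [RHS]big_nat_cond.
apply: eq_big => [s|[|s]]; [by case: (odd s) | by [] |].
by rewrite I_sumE.
Qed.

(** * From coalitions to lists of weights *)

Lemma hits_card (N : finType) (f : N -> nat) e m : uniq e ->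
  hits m (map f e) =
  #|[set S : {set N} | (S \subset e) && (\sum_(i in S) f i == m)]|.
Proof.
elim: e m => [|a e IHe] m /=.
  move=> _; have sub0 (S : {set N}) : (S \subset [::]) = (S == set0).
    by rewrite -subset0; apply: eq_subset_r => i; rewrite inE.
  case: (posnP m) => [->|m_gt0].
    rewrite (_ : [set S | _] = [set set0]) ?cards1 //.
    apply/setP => S; rewrite !inE sub0.
    by case: eqP => // ->; rewrite big_set0.
  rewrite (_ : [set S | _] = set0) ?cards0; first by lia.
  apply/setP => S; rewrite !inE sub0; case: eqP => // ->.
  by rewrite big_set0; lia.
case/andP=> a_notin ue; rewrite !IHe //.
rewrite -[RHS](cardsID [set S : {set N} | a \in S]).
rewrite addnC; congr addn; last first.
  apply: eq_card => S; rewrite !inE.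
  case aS: (a \in S) => /=.
    apply: contraNF a_notin => /andP[/subsetP subS _]; exact: subS.
  congr andb; apply/subsetP/subsetP => subS i iS; have := subS i iS.
    by rewrite inE => ->; rewrite orbT.
  by rewrite inE => /predU1P[eq_ia|//]; rewrite -eq_ia iS in aS.
have sumU (S : {set N}) : a \in S ->
    \sum_(i in S) f i = f a + \sum_(i in S :\ a) f i.
  by move=> aS; rewrite (big_setD1 a).
case: leqP => [le_am|lt_ma]; last first.
  apply/esym/eqP; rewrite cards_eq0; apply/eqP/setP => S; rewrite !inE.
  by case aS: (a \in S); rewrite ?andbF //= sumU //; lia.
have inj : {in [set S : {set N} | (S \subset e) &&
     (\sum_(i in S) f i == m - f a)] &, injective (setU [set a])}.
  have nin (S : {set N}) : S \subset e -> a \notin S.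
    by move=> /subsetP subS; apply: contra a_notin; exact: subS.
  move=> S T; rewrite !inE => /andP[/nin aS _] /andP[/nin aT _] eqST.
  by rewrite -(setU1K aS) -(setU1K aT) eqST.
rewrite -(card_in_imset inj); apply: eq_card => S; rewrite !inE.
apply/imsetP/idP => [[T]|/andP[/andP[/subsetP subS sumS] aS]].
  rewrite inE => /andP[/subsetP subT /eqP sumT] ->; rewrite setU11 andbT.
  have aT : a \notin T by apply: contra a_notin; exact: subT.
  rewrite big_setU1 //= sumT subnKC // eqxx andbT.
  apply/subsetP => i; rewrite !inE; case: eqP => //= _; exact: subT.
exists (S :\ a); last by rewrite setD1K.
rewrite inE; move: sumS; rewrite sumU // => /eqP <-.
rewrite addKn eqxx andbT; apply/subsetP => i; rewrite !inE.
by case/andP=> ne_ia /subS; rewrite inE (negPf ne_ia).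
Qed.

(** A player of nonpositive weight can leave any winning coalition, hence lies in no minimal one. *)
Lemma weight_gt0 (N : finType) (v : {set N} -> bool) q w :
  (forall i, ~ dummy v i) -> min_hom_rep v q w -> forall i, (0 < w i)%R.
Proof.
move=> no_dummy [_ vE _ hom] i; rewrite ltNge; apply/negP => w_le0.
apply: (no_dummy i) => S S_min; apply/negP => iS.
have wS := hom S S_min; move: (S_min); rewrite inE => /minsetP[_ minS].
have /minS : v (S :\ i).
  rewrite vE -wS /weight (big_setD1 i iS) /=.
  by rewrite -[leRHS]add0r lerD2r.
by move/(_ (subD1set _ _)) => eqS; rewrite -eqS !inE eqxx in iS.
Qed.

Lemma nat_representation (N : finType) (v : {set N} -> bool) q w :
    (forall i, ~ dummy v i) -> min_hom_rep v q w ->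
  exists (f : N -> nat) (m : nat),
  [/\ forall i, w i = Posz (f i), forall i, 0 < f i, q = Posz m,
      2 * m = (\sum_i f i).+1
    & [/\ forall S : {set N}, v S = (m <= \sum_(i in S) f i) &
      forall S, (S \in min_winning v) = (\sum_(i in S) f i == m)]].
Proof.
move=> no_dummy rep; have w_gt0 := weight_gt0 _ _ _ _ no_dummy rep.
case: rep => _ vE qE hom.
pose f i := `|w i|%N; have wE i : w i = Posz (f i).
  by rewrite /f gez0_abs // ltW.
have weightE (S : {set N}) : weight w S = Posz (\sum_(i in S) f i).
  rewrite /weight -[RHS]natz natr_sum.
  by apply: eq_bigr => i _; rewrite wE natz.
have sumT : (\sum_(i in [set: N]) f i = \sum_i f i)%N.
  by apply: eq_bigl => i; rewrite inE.
have f_gt0 i : 0 < f i by have := w_gt0 i; rewrite wE.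
have q_ge0 : (0 <= q)%R by rewrite weightE in qE; lia.
exists f, `|q|%N; split=> //; first by rewrite gez0_abs.
  by rewrite weightE sumT in qE; lia.
split=> S; first by rewrite vE weightE; lia.
apply/idP/eqP => [/hom|eqS]; first by rewrite weightE; lia.
rewrite inE; apply/minsetP; split; first by rewrite vE weightE; lia.
move=> T vT sTS; apply/eqP; rewrite eqEsubset sTS; apply/subsetP => i iS.
apply: contraLR vT => iT; rewrite vE weightE.
have : (\sum_(j in T) f j <= \sum_(j in S :\ i) f j)%N.
  rewrite [leqRHS](big_setID T) /= (setIidPr _) ?leq_addr //.
  by rewrite subsetD1 sTS.
have := eqS; rewrite (big_setD1 i iS) /=; have := f_gt0 i; lia.
Qed.

Lemma parsimonious_chain (N : finType) (v : {set N} -> bool)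
    (f : N -> nat) (m : nat) :
    (forall i, ~ dummy v i) -> #|min_winning v| = #|N| -> 3 < #|N| ->
    (forall i, 0 < f i) -> 2 * m = (\sum_i f i).+1 ->
    (forall S : {set N}, v S = (m <= \sum_(i in S) f i)) ->
    (forall S, (S \in min_winning v) = (\sum_(i in S) f i == m)) ->
  exists a l, [/\ perm_eq (a :: l) (map f (enum N)), sorted geq (a :: l),
    l != [::], chain l & a \notin l /\ m = (sumn (behead l)).+1].
Proof.
move=> no_dummy card_min N_gt3 f_gt0 sum_f vE minE.
pose e := sort (fun i j => f j <= f i) (enum N).
have perm_e : perm_eq e (enum N) by rewrite perm_sort.
have uniq_e : uniq e by rewrite (perm_uniq perm_e) enum_uniq.
have mem_e i : i \in e by rewrite (perm_mem perm_e) mem_enum.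
have size_e : size e = #|N| by rewrite (perm_size perm_e) -cardE.
have sorted_e : sorted geq (map f e).
  by rewrite sorted_map; apply: sort_sorted => i j; exact: leq_total.
have pos_e : all (leq 1) (map f e) by apply/allP => _ /mapP[i _ ->].
have sum_seq (t : seq N) : uniq t ->
    \sum_(i in [set j in t]) f i = sumn (map f t).
  move=> ut; rewrite sumnE big_map big_uniq //=.
  by apply: eq_bigl => i; rewrite inE.
(* A minimal completion from the list is a minimal winning coalition, so [minE] gives its weight. *)
have hom_e : homog m (map f e).
  move=> _ /subseqP[b _ ->]; rewrite -map_mask; set t := mask b e.
  have ut : uniq t by exact: mask_uniq.
  rewrite -sum_seq // => le_t min_t; apply/eqP; rewrite -minE inE.
  apply/minsetP; split; first by rewrite vE.
  move=> T vT sTS; apply/eqP; rewrite eqEsubset sTS; apply/subsetP => i it.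
  apply: contraLR vT => iT; rewrite vE -ltnNge.
  have := min_t (f i); rewrite map_f; last by rewrite inE in it.
  move=> /(_ isT); rewrite (big_setD1 i it) /= addnC ltn_add2r.
  apply: leq_ltn_trans; rewrite [leqRHS](big_setID T) /=.
  rewrite (setIidPr _) ?leq_addr //.
  by rewrite subsetD1 sTS.
have hits_e : hits m (map f e) = size (map f e).
  rewrite hits_card // size_map size_e -card_min; apply: eq_card => S.
  rewrite minE inE; case: subsetP => //= -[] i _; exact: mem_e.
have sum_e : 2 * m = (sumn (map f e)).+1.
  rewrite sum_f -sum_seq //; congr _.+1; apply: eq_bigl => i.
  by rewrite inE mem_e.
have perm_fe : perm_eq (map f e) (map f (enum N)) by exact: perm_map.
have size_gt3 : 3 < size e by rewrite size_e.
have last_e k i0 : e = rcons k i0 -> uses_last m (map f k) (f i0).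
  move=> eq_e; case: (boolP [exists S in min_winning v, i0 \in S]); last first.
    move/exists_inPn => dummy_i0; case: (no_dummy i0) => S; exact: dummy_i0.
  case/exists_inP => S; rewrite minE => /eqP sumS i0S.
  (* The other members of a minimal winning coalition containing [i0]. *)
  exists (map f [seq i <- k | i \in S]); first exact/map_subseq/filter_subseq.
  move: uniq_e; rewrite eq_e rcons_uniq => /andP[i0_notin uk].
  rewrite -sum_seq ?filter_uniq // -sumS (big_setD1 i0 i0S) /= addnC.
  congr addn; apply: eq_bigl => i; rewrite !inE mem_filter.
  have := mem_e i; rewrite eq_e mem_rcons inE.
  by case: eqP => [->|_ /= ->]; rewrite ?(negPf i0_notin) ?andbT ?andbF.
move: sorted_e pos_e hom_e hits_e sum_e perm_fe size_gt3 last_e.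
case: (e) => [|i1 e'] //=; case/lastP: e' => [|k i0] //.
rewrite map_rcons => se pe he hte sue pfe size3 /(_ (i1 :: k) i0 erefl) us.
have size2 : 2 < size (rcons (map f k) (f i0)).
  by rewrite -map_rcons size_map.
have [ch notin mE] := chain_top (f i1) _ _ m size2 se pe sue he us hte.
exists (f i1), (rcons (map f k) (f i0)); split=> //.
by case: (map f k).
Qed.

(** * Types, multiplicities and the quota *)

Lemma type_weightsE (N : finType) (w : N -> int) (f : N -> nat) l :
    (forall i, w i = Posz (f i)) -> perm_eq l (map f (enum N)) ->
    sorted geq l ->
  type_weights w = map Posz (rev (undup l)).
Proof.
move=> wE perm_l sl; have /eq_map eq_w : w =1 Posz \o f by [].
have inj_Posz : injective Posz by move=> ? ? [].
apply: (sorted_eq le_trans le_anti).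
- by apply: sort_sorted; exact: le_total.
- rewrite sorted_map; apply: (@sub_sorted _ leq) => [a b|].
    by rewrite /= lez_nat.
  rewrite rev_sorted; apply: subseq_sorted (undup_subseq l) sl.
  exact: rev_trans leq_trans.
rewrite /type_weights perm_sort; apply: uniq_perm; rewrite ?undup_uniq //.
  by rewrite map_inj_uniq // rev_uniq undup_uniq.
move=> a; rewrite mem_undup codomE eq_w map_comp map_rev mem_rev.
apply/mapP/mapP => -[b]; rewrite -?(perm_mem perm_l) => b_in ->.
  by exists b; rewrite ?mem_undup.
by exists b; rewrite // -(perm_mem perm_l) -mem_undup.
Qed.

Lemma type_repE (N : finType) (w : N -> int) (f : N -> nat) l :
    (forall i, w i = Posz (f i)) -> perm_eq l (map f (enum N)) ->
    sorted geq l ->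
  type_rep w = rev (multiplicities l).
Proof.
move=> wE perm_l sl; rewrite /type_rep (type_weightsE _ _ f l) // -map_comp.
rewrite /multiplicities -map_rev; apply: eq_map => a /=.
rewrite (permP perm_l) count_map -sum1_card -sum1_count big_enum_cond /=.
by apply: eq_bigl => i; rewrite !inE wE.
Qed.

Local Open Scope ring_scope.

Theorem theorem6p1 (N : finType) (v : {set N} -> bool) (q : int) (w : N -> int)
    (h : nat) (x : seq nat)
    (Gpars : parsimonious v)
    (qw_rep : min_hom_rep v q w)
    (h_types : h = ntypes w)
    (h_ge2 : (2 <= h)%N)
    (x_free : x = free_type_rep w) :
  (~~ odd h ->
     q = (\sum_(1 <= s < h | odd s) I_sum x h s)%N%:Z)
  /\
  (odd h ->
     q = (1 + \sum_(2 <= s < h | ~~ odd s) I_sum x h s)%N%:Z).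
Proof.
case: Gpars => _ N_gt3 no_dummy card_min.
have [f [m [wE f_gt0 qE sum_f [vE minE]]]] :=
  nat_representation _ _ _ _ no_dummy qw_rep.
have [a [l [perm_al sal l_nil ch [a_notin mE]]]] :=
  parsimonious_chain _ _ _ _ no_dummy card_min N_gt3 f_gt0 sum_f vE minE.
(* The heaviest type has one player; this is the entry that the free type representation drops. *)
have mult_al : multiplicities (a :: l) = 1%N :: multiplicities l.
  rewrite /multiplicities /= (negPf a_notin) /= eqxx (count_memPn a_notin).
  congr cons; apply/eq_in_map => b; rewrite mem_undup /=.
  by case: eqP => // <- a_in; rewrite a_in in a_notin.
have hE : h = (size (multiplicities l)).+1.
  rewrite h_types /ntypes (type_weightsE _ _ _ _ wE perm_al sal).
  by rewrite size_map size_rev /= (negPf a_notin) /= size_map.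
have xE : x = rev (multiplicities l).
  rewrite x_free /free_type_rep -h_types hE (type_repE _ _ _ _ wE perm_al sal).
  by rewrite mult_al rev_cons -cats1 /= take_size_cat // size_rev.
have hx : h = (size x).+1 by rewrite xE size_rev.
(* The fold over all [h - 1] free entries has second component [parity_sum x h h]; by the chain it
   is also the quota. *)
have := parity_sum_foldr x h (size x); rewrite {1}hx ltnSn leqnn take_size -hx.
rewrite {1}xE revK chain_multiplicities ?(path_sorted sal) //.
move=> /(_ isT isT)[_]; rewrite -mE => {}mE.
by rewrite qE mE parity_sum_I_sum ?hx //; case: odd.
Qed.
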